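(* Let $\mathbb{F}$ be a field and let $A$ be an arbitrary (not necessarily unital, not necessarily countable-dimensional) locally matrix $\mathbb{F}$-algebra. Then its spectrum $\mathrm{Spec}(A)$ is a saturated subset of $\mathbb{SN}$.
   Context: An associative $\mathbb{F}$-algebra $A$ is a locally matrix algebra if every finite subset of $A$ is contained in a subalgebra $B\subset A$ with $B\cong M_n(\mathbb{F})$ for some $n\ge 1$ (the identity of $B$ need not be an identity of $A$). It is unital if it contains $1$. A Steinitz number is a formal product $\prod_{p} p^{r_p}$ over all primes $p$, with $r_p\in\mathbb{N}\cup\{0,\infty\}$; $\mathbb{SN}$ is the set of all of them, and $\mathbb{N}=\{1,2,\ldots\}\subset\mathbb{SN}$. Multiplication adds exponents ($\infty$ absorbing), divisibility is exponentwise $\le$, least common multiples are exponentwise suprema. For $s\in\mathbb{SN}$, $\Omega(s)$ is the set of $n\in\mathbb{N}$ dividing $s$. For $b\in\Omega(s)$, $s/b$ is obtained by subtracting exponents (with $\infty-k=\infty$), and for $a\in\mathbb{N}$, $\frac{a}{b}s:=a\cdot(s/b)$. For a unital locally matrix algebra $A$, $\mathbf{st}(A)$ is the least common multiple of the set of all $n\in\mathbb{N}$ such that there is a subalgebra $A'$ with $1\in A'\subseteq A$ and $A'\cong M_n(\mathbb{F})$. For a locally matrix algebra $A$ and an idempotent $0\ne e\in A$, $eAe$ is a unital locally matrix algebra; the spectrum is $\mathrm{Spec}(A)=\{\mathbf{st}(eAe)\mid e\in A,\ e\neq 0,\ e^2=e\}$. Write $s_1|_{fin}\,s_2$ if $s_1=s_2/b$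 for some $b\in\Omega(s_2)$. Steinitz numbers $s_1,s_2$ are rationally connected if $s_2=q\cdot s_1$ for some rational $q$, i.e. $s_2=\frac{a}{b}s_1$ for some $a\in\mathbb{N}$, $b\in\Omega(s_1)$. A subset $S\subset\mathbb{SN}$ is saturated if: 1) any two elements of $S$ are rationally connected; 2) if $s_2\in S$ and $s_1|_{fin}\,s_2$ then $s_1\in S$; 3) if $s, ns\in S$ with $n\in\mathbb{N}$, then $is\in S$ for all $1\le i\le n$. *)

(* Defs.v *)
From HB Require Import structures.
From mathcomp Require Import all_boot all_order all_algebra.
From mathcomp Require Import boolp classical_sets cardinality.

Set Implicit Arguments.
Unset Strict Implicit.
Unset Printing Implicit Defensive.

Import GRing.Theory.
Local Open Scope ring_scope.
Local Open Scope classical_set_scope.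

Inductive enat := Fin of nat | Inf.

HB.instance Definition _ := gen_eqMixin enat.
HB.instance Definition _ := gen_choiceMixin enat.

Definition enat_le (x y : enat) : Prop :=
  match x, y with
  | _, Inf => True
  | Inf, Fin _ => False
  | Fin m, Fin n => (m <= n)%N
  end.

Definition enat_add (x y : enat) : enat :=
  match x, y with
  | Fin m, Fin n => Fin (m + n)
  | _, _ => Inf
  end.

(* Truncated when [x < Fin k]; only used for divisors, where [Fin k <= x]. *)
Definition enat_subn (x : enat) (k : nat) : enat :=
  match x with
  | Fin m => Fin (m - k)
  | Inf => Inf
  end.

Definition is_enat_sup (X : set enat) (s : enat) : Prop :=
  (forall x, X x -> enat_le x s) /\
  (forall y, (forall x, X x -> enat_le x y) -> enat_le s y).

(* The default value of [xget] is never used, by [enat_supP]. *)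
Definition enat_sup (X : set enat) : enat := xget Inf [set s | is_enat_sup X s].

Lemma enat_supP (X : set enat) : is_enat_sup X (enat_sup X).
Proof.
apply: xgetPex; apply: contrapT => /forallNP nosup.
have noub n : ~ (forall x, X x -> enat_le x (Fin n)).
  elim/ltn_ind: n => n IHn ubn; apply: (nosup (Fin n)); split=> // -[m|] ubm //=.
  by rewrite leqNgt; apply/negP => /IHn; apply.
by apply: (nosup Inf); split=> [[n|] //|[n /noub|]].
Qed.

(* The value at [p] is the exponent of the prime [p]. *)
Definition steinitz : Type := {p : nat | prime p} -> enat.

(* Represents the Steinitz number [n] only when [0 < n]. *)
Definition sn_of_nat (n : nat) : steinitz := fun p => Fin (logn (val p) n).

Definition sn_mul (s t : steinitz) : steinitz := fun p => enat_add (s p) (t p).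

Definition sn_dvd (s t : steinitz) : Prop := forall p, enat_le (s p) (t p).

Definition sn_lcm (X : set steinitz) : steinitz :=
  fun p => enat_sup [set s p | s in X].

Definition Omega (s : steinitz) : set nat :=
  [set n | (0 < n)%N /\ sn_dvd (sn_of_nat n) s].

(* Meaningful for [b] in [Omega s]. *)
Definition sn_divn (s : steinitz) (b : nat) : steinitz :=
  fun p => enat_subn (s p) (logn (val p) b).

Definition dvd_fin (s1 s2 : steinitz) : Prop :=
  exists2 b, Omega s2 b & s1 = sn_divn s2 b.

Definition rationally_connected (s1 s2 : steinitz) : Prop :=
  exists a b : nat, [/\ (0 < a)%N, Omega s1 b
    & s2 = sn_mul (sn_of_nat a) (sn_divn s1 b)].

Definition saturated (S : set steinitz) : Prop :=
  [/\ forall s1 s2, S s1 -> S s2 -> rationally_connected s1 s2,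
      forall s1 s2, S s2 -> dvd_fin s1 s2 -> S s1
    & forall (s : steinitz) (n : nat), (0 < n)%N ->
        S s -> S (sn_mul (sn_of_nat n) s) ->
        forall i : nat, (1 <= i <= n)%N -> S (sn_mul (sn_of_nat i) s)].

(* The ring and algebra structures of MathComp all have a unit, hence this
   structure of associative algebra in which none is assumed. *)
HB.mixin Record Lmodule_isAssocAlgebra (F : fieldType) A
    of GRing.Lmodule F A := {
  amul : A -> A -> A;
  amulA : associative amul;
  amulDl : left_distributive amul +%R;
  amulDr : right_distributive amul +%R;
  amulZl : forall (c : F) (x y : A), amul (c *: x) y = c *: amul x y;
  amulZr : forall (c : F) (x y : A), amul x (c *: y) = c *: amul x y
}.

#[short(type="assocAlgType")]
HB.structure Definition AssocAlgebra (F : fieldType) :=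
  {A of GRing.Lmodule F A & Lmodule_isAssocAlgebra F A}.

Section LocallyMatrix.
Variables (F : fieldType) (A : assocAlgType F).
Implicit Types (B C : set A) (e u x y : A).

(* [B] is the image of an injective, linear and multiplicative map from the
   n x n matrices, that is, [B] is a subalgebra of [A] isomorphic to them. *)
Definition matrix_subalgebra (n : nat) B : Prop :=
  exists phi : {linear 'M[F]_n -> A},
    [/\ injective phi,
        forall M N : 'M[F]_n, phi (M *m N) = amul (phi M) (phi N)
      & range phi = B].

Definition locally_matrix : Prop :=
  forall X : set A, finite_set X ->
    exists n B, [/\ (0 < n)%N, matrix_subalgebra n B & X `<=` B].

Definition is_identity C u : Prop :=
  C u /\ forall x, C x -> amul u x = x /\ amul x u = x.

(* The Steinitz number of a subalgebra [C] of [A] that has an identity [u],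
   which may differ from the identity of [A], if any. *)
Definition st C : steinitz :=
  sn_lcm [set sn_of_nat n | n in [set n | (0 < n)%N /\
    exists B u, [/\ matrix_subalgebra n B, B `<=` C, is_identity C u & B u]]].

Definition corner e : set A := [set amul (amul e x) e | x in [set: A]].

Definition Spec : set steinitz :=
  [set st (corner e) | e in [set e | e <> 0 /\ amul e e = e]].

End LocallyMatrix.

Arguments locally_matrix {F} A.
Arguments Spec {F} A.

(* Main.v *)
(* A multiplicative linear map M_n -> M_m multiplies the ranks of idempotents by
   a constant k. Hence, if two idempotents e and f lie in a common matrix
   subalgebra of A and have ranks a and b there, every larger matrix subalgebra
   gives unital copies of M_(k a) in eAe and of M_(k b) in fAf for the same k,
   and these are cofinal among all unital matrix subalgebras. So st(eAe) = a t
   and st(fAf) = b t, where t is the least common multiple of these k. The three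
   conditions follow by choosing idempotents of suitable ranks. *)
Require Import Defs.
From mathcomp Require Import all_boot all_order all_algebra.
From mathcomp Require Import boolp classical_sets cardinality.

Set Implicit Arguments.
Unset Strict Implicit.
Unset Printing Implicit Defensive.

Import GRing.Theory.
Local Open Scope ring_scope.
Local Open Scope classical_set_scope.

(** * Arithmetic of Steinitz numbers *)

Section SteinitzNumbers.
Implicit Types (s t : steinitz).

Lemma enat_le_anti x y : enat_le x y -> enat_le y x -> x = y.
Proof.
by case: x y => [m|] [n|] //= mn nm; congr Fin; apply/eqP; rewrite eqn_leq mn.
Qed.

Lemma enat_sup_eq X x : is_enat_sup X x -> enat_sup X = x.
Proof.
have [ubX lubX] := enat_supP X; case=> ubx lubx.
by apply: enat_le_anti; [apply: lubX|apply: lubx].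
Qed.

Lemma enat_add_le_subn c x m :
  (c <= m)%N ->
  enat_le (enat_add (Fin c) x) (Fin m) <-> enat_le x (Fin (m - c)).
Proof. by case: x => [n|] //= cm; rewrite leq_subRL. Qed.

(** The multiples k r with k in [K] are cofinal in [U] for divisibility, so both families have the
    same exponent suprema, and the factor r comes out of the supremum. *)
Lemma sn_lcm_cofinal (U K : set nat) r : (0 < r)%N -> K !=set0 ->
  (forall k, K k -> (0 < k)%N /\ U (k * r)%N) ->
  (forall n, U n -> exists2 k, K k & (n %| k * r)%N) ->
  sn_lcm (sn_of_nat @` U) = sn_mul (sn_of_nat r) (sn_lcm (sn_of_nat @` K)).
Proof.
move=> r0 [k0 Kk0] KU UK; apply: funext => p; apply: enat_sup_eq.
rewrite /sn_mul /sn_lcm.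
have [ubK lubK] := enat_supP [set t p | t in sn_of_nat @` K].
have lognK k : K k -> enat_le (Fin (logn (val p) k))
    (enat_sup [set t p | t in sn_of_nat @` K]).
  by move=> Kk; apply: ubK; exists (sn_of_nat k) => //; exists k.
split=> [_ [_ [n Un <-] <-]|y ub].
  have [k Kk nkr] := UK n Un; have [k_gt0 _] := KU k Kk.
  have := dvdn_leq_log (val p) (_ : 0 < k * r)%N nkr.
  rewrite muln_gt0 k_gt0 r0 lognM // => /(_ isT) le_n.
  move: (lognK k Kk); rewrite /sn_of_nat; case: (enat_sup _) => //= m le_k.
  by apply: leq_trans le_n _; rewrite addnC leq_add2l.
have ubk k : K k -> enat_le (Fin (logn (val p) r + logn (val p) k)) y.
  move=> Kk; have [k_gt0 Ukr] := KU k Kk; apply: ub.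
  exists (sn_of_nat (k * r)); first by exists (k * r)%N.
  by rewrite /sn_of_nat lognM // addnC.
case: y ub ubk => [m|] // _ ubk; last by case: (enat_add _ _).
(* An element of [K] is needed here: it shows that the exponent of r can be subtracted from the
   bound without truncation. *)
have le_rm : (logn (val p) r <= m)%N.
  exact: leq_trans (leq_addr _ _) (ubk _ Kk0).
apply/enat_add_le_subn => //; apply: lubK => _ [_ [k Kk <-] <-] /=.
by rewrite leq_subRL //; apply: ubk.
Qed.

Lemma sn_mulA s t u : sn_mul s (sn_mul t u) = sn_mul (sn_mul s t) u.
Proof.
apply: funext => p; rewrite /sn_mul.
by case: (s p) (t p) (u p) => [a|] [b|] [c|] //=; rewrite addnA.
Qed.

Lemma sn_of_natM m n : (0 < m)%N -> (0 < n)%N ->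
  sn_of_nat (m * n) = sn_mul (sn_of_nat m) (sn_of_nat n).
Proof. by move=> m0 n0; apply: funext => p; rewrite /sn_of_nat lognM. Qed.

Lemma sn_mulKn r t : sn_divn (sn_mul (sn_of_nat r) t) r = t.
Proof.
apply: funext => p; rewrite /sn_divn /sn_mul.
by case: (t p) => //= n; rewrite addKn.
Qed.

Lemma Omega_mul r t : (0 < r)%N -> Omega (sn_mul (sn_of_nat r) t) r.
Proof.
by split=> // p; rewrite /sn_mul; case: (t p) => //= n; rewrite leq_addr.
Qed.

Lemma sn_mul_pfactor (p : {p | prime p}) k t : t p = Inf ->
  sn_mul (sn_of_nat (val p ^ k)) t = t.
Proof.
move=> tp; apply: funext => q; rewrite /sn_mul /sn_of_nat.
have [->|qp] := eqVneq q p; first by rewrite tp.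
by rewrite lognX logn_prime ?(valP p) // val_eqE (negbTE qp) muln0; case: (t q).
Qed.

(** Finite exponents cancel at each prime, and a positive integer is determined by its exponents. *)
Lemma sn_mul_of_nat_inj m n t : (0 < m)%N -> (0 < n)%N ->
  (forall p, t p <> Inf) ->
  sn_mul (sn_of_nat m) t = sn_mul (sn_of_nat n) t -> m = n.
Proof.
move=> m0 n0 fin eq_mn; apply: eqn_from_log => // p.
have [pr_p|npr_p] := boolP (prime p); last first.
  by rewrite lognE [RHS]lognE (negbTE npr_p).
have := congr1 (@^~ (exist _ p pr_p)) eq_mn; move: (fin (exist _ p pr_p)).
rewrite /sn_mul /sn_of_nat /=; case: (t _) => //= c _ [].
exact: addIn.
Qed.

End SteinitzNumbers.

(** * Ranks of idempotent matrices under multiplicative maps *)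

Section IdempotentRank.
Variable F : fieldType.

Lemma idem_mx_factor n (E : 'M[F]_n) : E *m E = E ->
  exists (C : 'M_(n, \rank E)) (R : 'M_(\rank E, n)),
    C *m R = E /\ R *m C = 1%:M.
Proof.
move=> EE; exists (col_base E), (row_base E); split; first exact: mulmx_base.
move: (mulVpmx (col_base_full E)) (mulmxVp (row_base_free E)) (mulmx_base E).
move: (pinvmx (col_base E)) (pinvmx (row_base E)) => C' R'.
move: (col_base E) (row_base E) => C R CK RK CR.
(* With C' a left inverse of C and R' a right inverse of R, RC = C'(CR)(CR)R' = C'(CR)R' = 1. *)
transitivity (C' *m (C *m R *m (C *m R)) *m R').
  by rewrite !mulmxA CK mul1mx -(mulmxA _ R) RK mulmx1.
by rewrite CR EE -[X in _ *m X *m _]CR mulmxA CK mul1mx RK.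
Qed.

Lemma pid_mx_idem n r : (r <= n)%N ->
  (pid_mx r : 'M[F]_n) *m (pid_mx r : 'M[F]_n) = pid_mx r.
Proof. exact: pid_mx_id. Qed.

(** The row space of the sum is the direct sum of the two row spaces: E1 (E1 + E2) = E1, and a
    vector v = b E2 fixed by E1 equals b E2 E1 = 0. *)
Lemma mxrank_add_orthogonal n (E1 E2 : 'M[F]_n) :
  E1 *m E1 = E1 -> E2 *m E2 = E2 -> E1 *m E2 = 0 -> E2 *m E1 = 0 ->
  \rank (E1 + E2)%R = (\rank E1 + \rank E2)%N.
Proof.
move=> E11 E22 E12 E21; rewrite -mxrank_disjoint_sum.
  apply: eqmx_rank; apply/andP; split; first by rewrite addmx_sub_adds.
  rewrite addsmx_sub; apply/andP; split.
    by apply/submxP; exists E1; rewrite mulmxDr E11 E12 addr0.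
  by apply/submxP; exists E2; rewrite mulmxDr E22 E21 add0r.
apply/eqP; rewrite -submx0; apply/rV_subP => v.
rewrite sub_capmx => /andP[/submxP[a ->] /submxP[b ab]].
by rewrite -E11 mulmxA ab -mulmxA E21 mulmx0 sub0mx.
Qed.

Section Embedding.
Variables (n m : nat) (phi : 'M[F]_n -> 'M[F]_m).
Hypotheses (phiD : forall M N, phi (M + N) = phi M + phi N)
  (phiM : forall M N, phi (M *m N) = phi M *m phi N).

(** If PQ is idempotent, phi(PQ) = phi(P) phi(QP) phi(Q), which bounds its rank by that of
    phi(QP). *)
Lemma mxrank_morph_swap (X Y : 'M_n) :
  X *m Y *m (X *m Y) = X *m Y -> Y *m X *m (Y *m X) = Y *m X ->
  \rank (phi (X *m Y)) = \rank (phi (Y *m X)).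
Proof.
suff le (P Q : 'M_n) : P *m Q *m (P *m Q) = P *m Q ->
    (\rank (phi (P *m Q)) <= \rank (phi (Q *m P)))%N.
  by move=> idXY idYX; apply/eqP; rewrite eqn_leq !le.
move=> <-; rewrite -mulmxA (mulmxA Q) !(phiM P) (phiM (Q *m P)).
by apply: leq_trans (mxrankM_maxr _ _) (mxrankM_maxl _ _).
Qed.

(** Idempotents C1 R1 and C2 R2 of equal rank have the form XY and YX, with X = C1 R2 and Y = C2
    R1. *)
Lemma mxrank_morph_idem_eq (E1 E2 : 'M_n) :
  E1 *m E1 = E1 -> E2 *m E2 = E2 -> \rank E1 = \rank E2 ->
  \rank (phi E1) = \rank (phi E2).
Proof.
move=> E11 E22; have [C1 [R1 [CR1 RC1]]] := idem_mx_factor E11.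
have [C2 [R2 [CR2 RC2]]] := idem_mx_factor E22.
(* The factors are generalized so that rewriting with [rE] also changes their dimensions; otherwise
   [C1 *m R2] is ill-typed. *)
move: C1 R1 CR1 RC1 C2 R2 CR2 RC2 => + + + + + + + + rE.
rewrite rE => C1 R1 CR1 RC1 C2 R2 CR2 RC2.
have e1 : (C1 *m R2) *m (C2 *m R1) = E1.
  by rewrite -mulmxA (mulmxA R2) RC2 mul1mx.
have e2 : (C2 *m R1) *m (C1 *m R2) = E2.
  by rewrite -mulmxA (mulmxA R1) RC1 mul1mx.
rewrite -[in phi E1]e1 -[in phi E2]e2.
by apply: mxrank_morph_swap; rewrite ?e1 ?e2.
Qed.

Lemma mxrank_morph_idem :
  exists k, forall E, E *m E = E -> \rank (phi E) = (k * \rank E)%N.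
Proof.
(* The constant is the rank of the image of a rank one idempotent. Every idempotent may be replaced
   by a [pid_mx] of its rank, which is built up by adding orthogonal rank one idempotents [D]. *)
exists (\rank (phi (pid_mx 1))) => E EE.
have phi0 : phi 0 = 0.
  by have := phiD 0 0; rewrite addr0 => /(canLR (addrK _)); rewrite subrr.
have idp := pid_mx_idem (rank_leq_row E).
rewrite (mxrank_morph_idem_eq EE idp) ?rank_pid_mx ?rank_leq_row //.
elim: (\rank E) (rank_leq_row E) => [|r IHr] rn.
  by rewrite pid_mx_0 muln0 phi0 mxrank0.
have idr := pid_mx_idem (ltnW rn); have idr1 := pid_mx_idem rn.
pose D : 'M[F]_n := pid_mx r.+1 - pid_mx r.
have rD : (pid_mx r : 'M_n) *m D = 0.
  rewrite /D mulmxBr idr mul_pid_mx.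
  by rewrite (minn_idPl (_ : r <= r.+1)%N) // (minn_idPr (ltnW rn)) subrr.
have Dr : D *m (pid_mx r : 'M_n) = 0.
  rewrite /D mulmxBl idr mul_pid_mx.
  by rewrite (minn_idPr (_ : r <= r.+1)%N) // (minn_idPr (ltnW rn)) subrr.
have DD : D *m D = D.
  rewrite {1}/D mulmxBl rD subr0 /D mulmxBr idr1 mul_pid_mx.
  by rewrite (minn_idPr (_ : r <= r.+1)%N) // (minn_idPr (ltnW rn)).
have eD : pid_mx r.+1 = pid_mx r + D by rewrite addrC subrK.
have rkD : \rank D = 1%N.
  apply: (@addnI r).
  rewrite -[in LHS](rank_pid_mx F (ltnW rn) (ltnW rn)).
  by rewrite -mxrank_add_orthogonal // -eD rank_pid_mx // addn1.
rewrite eD phiD mxrank_add_orthogonal -?phiM ?idr ?DD ?rD ?Dr //.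
rewrite IHr 1?ltnW // mulnS addnC; congr addn.
have n1 : (1 <= n)%N by apply: leq_trans rn.
by apply: mxrank_morph_idem_eq => //; rewrite ?pid_mx_idem ?rank_pid_mx.
Qed.

End Embedding.

End IdempotentRank.

(** * Unital matrix subalgebras of corners *)

Section UnitalSize.
Variables (F : fieldType) (A : assocAlgType F).
Implicit Types (e f : A).

Definition unital_size e n : Prop :=
  (0 < n)%N /\ exists phi : {linear 'M[F]_n -> A},
    [/\ injective phi, forall M N, phi (M *m N) = amul (phi M) (phi N)
      & phi 1%:M = e].

(** The identity of eAe is e, and an embedding sending 1 to e has image in eAe, since phi(M) = e
    phi(M) e. *)
Lemma st_corner e : amul e e = e ->
  st (corner e) = sn_lcm [set sn_of_nat n | n in unital_size e].
Proof.
move=> ee; congr (sn_lcm (_ @` _)); apply/seteqP; split=> n /=.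
  case=> n0 [_ [u [[phi [inj phiM <-]] BC [Cu idu] [U _ Uu]]]].
  have Ce : corner e e by exists e => //; rewrite !ee.
  have uE : u = e.
    by have [<- _] := idu e Ce; case: Cu => x _ <-; rewrite -[in RHS]amulA ee.
  split=> //; exists phi; split=> //; rewrite -uE -Uu; congr (phi _).
  have [] := idu (phi 1%:M); first by apply: BC; exists 1%:M.
  by rewrite -Uu -phiM mulmx1 => /inj.
case=> n0 [phi [inj phiM phi1]]; split=> //; exists (range phi), e; split.
- by exists phi.
- move=> _ [M _ <-]; exists (phi M) => //.
  by rewrite -phi1 -!phiM mulmx1 mul1mx.
- split; first by exists e => //; rewrite ee.
  by move=> _ [x _ <-]; rewrite !amulA ee -!amulA ee.
- by exists 1%:M.
Qed.

Lemma unital_size_rank n (phi : {linear 'M[F]_n -> A}) (E : 'M[F]_n) :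
  injective phi -> (forall M N, phi (M *m N) = amul (phi M) (phi N)) ->
  E *m E = E -> (0 < \rank E)%N -> unital_size (phi E) (\rank E).
Proof.
move=> inj phiM EE rE; split=> //.
have [C [R [CR RC]]] := idem_mx_factor EE.
(* For E = CR with RC = 1, the map M -> C M R is multiplicative, injective and sends 1 to E. *)
exists (phi \o (mulmxr R \o mulmx C)); split=> /=.
- move=> M N /inj/(congr1 (mulmx R))/(congr1 (mulmxr C)) /=.
  by rewrite !mulmxA RC !mul1mx -!mulmxA RC !mulmx1.
- move=> M N; rewrite -phiM; congr (phi _).
  by rewrite -!mulmxA (mulmxA R) RC mul1mx.
- by rewrite mulmx1 CR.
Qed.

(** Turns an inclusion of matrix subalgebras into a map between matrix rings, to which the rank
    lemmas apply. Matrix units suffice by linearity; injectivity of [phi] makes the chosen preimages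
    additive and multiplicative. *)
Lemma matrix_morph_factor n m (phi : {linear 'M[F]_n -> A})
    (psi : {linear 'M[F]_m -> A}) :
  injective phi ->
  (forall M N, phi (M *m N) = amul (phi M) (phi N)) ->
  (forall M N, psi (M *m N) = amul (psi M) (psi N)) ->
  (forall i j, range phi (psi (delta_mx i j))) ->
  exists chi : 'M[F]_m -> 'M[F]_n, [/\ forall M, phi (chi M) = psi M,
    forall M N, chi (M + N) = chi M + chi N
    & forall M N, chi (M *m N) = chi M *m chi N].
Proof.
move=> inj phiM psiM basis.
have ex M : exists N, phi N = psi M.
  have basis_ex p : exists N, phi N = psi (delta_mx p.1 p.2).
    by have [N _ NE] := basis p.1 p.2; exists N.
  have [f fE] := choice basis_ex.
  exists (\sum_i \sum_j M i j *: f (i, j)).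
  rewrite [in RHS](matrix_sum_delta M) !linear_sum; apply: eq_bigr => i _.
  by rewrite !linear_sum; apply: eq_bigr => j _; rewrite !linearZ fE.
have [chi chiE] := choice ex; exists chi; split=> // M N; apply: inj.
- by rewrite linearD !chiE linearD.
- by rewrite phiM !chiE psiM.
Qed.

(** * Comparison of corners inside larger matrix subalgebras *)

Hypothesis hA : locally_matrix A.

Lemma locally_matrix_extend n m (phi : {linear 'M[F]_n -> A})
    (psi : {linear 'M[F]_m -> A}) :
  exists L (Phi : {linear 'M[F]_L -> A}), [/\ injective Phi,
    forall M N, Phi (M *m N) = amul (Phi M) (Phi N),
    forall i j, range Phi (phi (delta_mx i j))
    & forall i j, range Phi (psi (delta_mx i j))].
Proof.
pose X := [set phi (delta_mx p.1 p.2) | p in [set: 'I_n * 'I_n]] `|`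
          [set psi (delta_mx p.1 p.2) | p in [set: 'I_m * 'I_m]].
have finX : finite_set X.
  by rewrite finite_setU; split; apply: finite_image; apply: finite_finset.
have [L [_ [_ [Phi [inj PhiM <-]] XB]]] := hA finX.
exists L, Phi; split=> // i j; apply: XB; [left|right].
- by exists (i, j).
- by exists (i, j).
Qed.

(** In a matrix subalgebra containing the images of [phi] and [psi], ranks get multiplied by k and l
    respectively. As [psi] sends 1 to [phi E1], this gives k rank(E1) = l m. *)
Lemma unital_size_common n (phi : {linear 'M[F]_n -> A}) (E1 E2 : 'M[F]_n) m :
  injective phi -> (forall M N, phi (M *m N) = amul (phi M) (phi N)) ->
  E1 *m E1 = E1 -> E2 *m E2 = E2 -> (0 < \rank E1)%N -> (0 < \rank E2)%N ->
  unital_size (phi E1) m ->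
  exists k, [/\ (0 < k)%N, (m %| k * \rank E1)%N,
    unital_size (phi E1) (k * \rank E1)
    & unital_size (phi E2) (k * \rank E2)].
Proof.
move=> phi_inj phiM E11 E22 rE1 rE2 [m0 [psi [psi_inj psiM psi1]]].
have [L [Phi [Phi_inj PhiM Pphi Ppsi]]] := locally_matrix_extend phi psi.
have [chi [chiE chiD chiM]] := matrix_morph_factor Phi_inj PhiM phiM Pphi.
have [xi [xiE xiD xiM]] := matrix_morph_factor Phi_inj PhiM psiM Ppsi.
have [k kP] := mxrank_morph_idem chiD chiM.
have [l lP] := mxrank_morph_idem xiD xiM.
have xi1 : xi 1%:M = chi E1 by apply: Phi_inj; rewrite xiE chiE.
have chi_neq0 : chi E1 != 0.
  apply/eqP => chi0; move: rE1; rewrite (_ : E1 = 0) ?mxrank0 //.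
  by apply: phi_inj; rewrite -chiE chi0 !linear0.
have k0 : (0 < k)%N.
  move: chi_neq0; rewrite -mxrank_eq0 kP // -lt0n muln_gt0.
  by case/andP.
have size E : E *m E = E -> (0 < \rank E)%N ->
    unital_size (phi E) (k * \rank E).
  move=> EE rE; rewrite -chiE -kP //; apply: unital_size_rank => //.
    by rewrite -chiM EE.
  by rewrite kP // muln_gt0 k0.
exists k; split=> //; try exact: size.
by rewrite -kP // -xi1 lP ?mulmx1 // mxrank1 dvdn_mull.
Qed.

Lemma st_common n (phi : {linear 'M[F]_n -> A}) (E1 E2 : 'M[F]_n) :
  injective phi -> (forall M N, phi (M *m N) = amul (phi M) (phi N)) ->
  E1 *m E1 = E1 -> E2 *m E2 = E2 -> (0 < \rank E1)%N -> (0 < \rank E2)%N ->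
  exists t, st (corner (phi E1)) = sn_mul (sn_of_nat (\rank E1)) t /\
            st (corner (phi E2)) = sn_mul (sn_of_nat (\rank E2)) t.
Proof.
move=> phi_inj phiM E11 E22 rE1 rE2.
have size1 : unital_size (phi E1) (\rank E1) by exact: unital_size_rank.
have size2 : unital_size (phi E2) (\rank E2) by exact: unital_size_rank.
(* The same set of multipliers serves both corners, so both Steinitz numbers share the factor t. *)
pose K : set nat := [set k | [/\ (0 < k)%N, unital_size (phi E1) (k * \rank E1)
  & unital_size (phi E2) (k * \rank E2)]].
have K_neq0 : K !=set0 by exists 1%N; rewrite /K /= !mul1n.
exists (sn_lcm (sn_of_nat @` K)); rewrite !st_corner -?phiM ?E11 ?E22 //.
split; apply: sn_lcm_cofinal => // [k []|m size_m] //.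
  have [k [k0 mk k1 k2]] :=
    unital_size_common phi_inj phiM E11 E22 rE1 rE2 size_m.
  by exists k.
have [k [k0 mk k2 k1]] :=
  unital_size_common phi_inj phiM E22 E11 rE2 rE1 size_m.
by exists k.
Qed.

Lemma idem_common e f : e <> 0 -> amul e e = e -> f <> 0 -> amul f f = f ->
  exists n (phi : {linear 'M[F]_n -> A}) (E1 E2 : 'M[F]_n),
    [/\ injective phi, forall M N, phi (M *m N) = amul (phi M) (phi N),
      [/\ phi E1 = e, E1 *m E1 = E1 & (0 < \rank E1)%N]
      & [/\ phi E2 = f, E2 *m E2 = E2 & (0 < \rank E2)%N]].
Proof.
move=> e0 ee f0 ff.
have fin : finite_set [set e; f].
  by rewrite finite_setU; split; exact: finite_set1.
have [n [_ [_ [phi [inj phiM <-]] XB]]] := hA fin.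
have [E1 _ E1e] := XB e (or_introl erefl).
have [E2 _ E2f] := XB f (or_intror erefl).
have idem E : phi E <> 0 -> amul (phi E) (phi E) = phi E ->
    E *m E = E /\ (0 < \rank E)%N.
  move=> E0 EE; split; first by apply: inj; rewrite phiM.
  by rewrite lt0n mxrank_eq0; apply/eqP => E_0; apply: E0; rewrite E_0 linear0.
subst e f; have [? ?] := idem _ e0 ee; have [? ?] := idem _ f0 ff.
by exists n, phi, E1, E2.
Qed.

(** * The saturation conditions *)

Lemma Spec_rationally_connected s1 s2 :
  Spec A s1 -> Spec A s2 -> rationally_connected s1 s2.
Proof.
move=> [e [e0 ee] <-] [f [f0 ff] <-].
have [n [phi [E1 [E2 [inj phiM [<- E11 r1] [<- E22 r2]]]]]] :=
  idem_common e0 ee f0 ff.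
have [t [-> ->]] := st_common inj phiM E11 E22 r1 r2.
by exists (\rank E2), (\rank E1); split; rewrite ?sn_mulKn //; exact: Omega_mul.
Qed.

(* The second value is attained at the image of a diagonal idempotent of rank r
   under a unital embedding of the n x n matrices in eAe. *)
Lemma Spec_unital_size e n r : unital_size e n -> (0 < r <= n)%N ->
  exists2 t, st (corner e) = sn_mul (sn_of_nat n) t
    & Spec A (sn_mul (sn_of_nat r) t).
Proof.
case=> n0 [phi [inj phiM <-]] /andP[r0 rn].
have rk : \rank (pid_mx r : 'M[F]_n) = r by rewrite rank_pid_mx.
have := st_common inj phiM (mulmx1 _) (pid_mx_idem F rn).
rewrite mxrank1 rk => /(_ n0 r0)[t [-> st_r]]; exists t => //.
exists (phi (pid_mx r)) => //; split; last by rewrite -phiM pid_mx_idem.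
rewrite -(linear0 phi) => /inj/(congr1 (@mxrank F n n)).
by rewrite mxrank0 rk => r_0; rewrite r_0 in r0.
Qed.

Lemma unital_size_directed e m n : unital_size e m -> unital_size e n ->
  exists l, [/\ unital_size e l, (m %| l)%N & (n %| l)%N].
Proof.
move=> [m0 [phi [inj phiM <-]]] size_n.
have rk1 : (0 < \rank (1%:M : 'M[F]_m))%N by rewrite mxrank1.
have [k [_]] :=
  unital_size_common inj phiM (mulmx1 _) (mulmx1 _) rk1 rk1 size_n.
rewrite mxrank1 => nk size_km _.
by exists (k * m)%N; split=> //; exact: dvdn_mull.
Qed.

Lemma unital_size_ex e : e <> 0 -> amul e e = e -> exists n, unital_size e n.
Proof.
move=> e0 ee.
have [n [phi [E [_ [inj phiM [<- EE rE] _]]]]] := idem_common e0 ee e0 ee.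
by exists (\rank E); exact: unital_size_rank.
Qed.

Lemma st_le_ex e p m : e <> 0 -> amul e e = e ->
  enat_le (Fin m) (st (corner e) p) ->
  exists2 n, unital_size e n & (m <= logn (val p) n)%N.
Proof.
(* For exponent 0 any size will do. For m + 1, if no size reached it, m would bound all exponents
   and hence their supremum. *)
move=> e0 ee; rewrite st_corner //; case: m => [|m] le_m.
  by have [n size_n] := unital_size_ex e0 ee; exists n.
apply: contrapT => no_n.
have [_ /(_ (Fin m))] := enat_supP [set s p | s in sn_of_nat @` unital_size e].
move: le_m; rewrite /sn_lcm; case: (enat_sup _) => [l|] /= ml lub.
  suff : (l <= m)%N by rewrite leqNgt ml.
  apply: lub => _ [_ [n size_n <-] <-]; rewrite /= leqNgt.
  by apply/negP => mn; apply: no_n; exists n.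
apply: lub => _ [_ [n size_n <-] <-]; rewrite /= leqNgt.
by apply/negP => mn; apply: no_n; exists n.
Qed.

(** Each prime power in b divides some unital size; directedness merges the finitely many sizes into
    one. *)
Lemma Omega_st e b : e <> 0 -> amul e e = e -> Omega (st (corner e)) b ->
  exists2 n, unital_size e n & (b %| n)%N.
Proof.
move=> e0 ee [b0 dvd_b].
suff [n size_n le_n] : exists2 n, unital_size e n &
    forall p, p \in primes b -> (logn p b <= logn p n)%N.
  have n0 : (0 < n)%N by case: size_n.
  exists n => //; apply/dvdn_partP => // p p_b; rewrite p_part.
  by rewrite pfactor_dvdn ?le_n //; move: p_b; rewrite mem_primes => /andP[].
(* Induction on a list of primes, with its inclusion in [primes b] kept as a hypothesis to know that
   its members are prime. *)
have : {subset primes b <= primes b} by [].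
elim: {1 3}(primes b) => [|p ps IHps] sub.
  by have [n size_n] := unital_size_ex e0 ee; exists n.
have pr_p : prime p.
  by have := sub p (mem_head _ _); rewrite mem_primes => /andP[].
have [|m size_m le_m] := IHps.
  by move=> q q_ps; apply: sub; rewrite inE q_ps orbT.
have [n size_n le_n] := st_le_ex e0 ee (dvd_b (exist _ p pr_p)).
have [l [size_l ml nl]] := unital_size_directed size_m size_n.
have l0 : (0 < l)%N by case: size_l.
exists l => // q; rewrite inE => /predU1P[->|/le_m le_q].
  exact: leq_trans le_n (dvdn_leq_log _ l0 nl).
exact: leq_trans le_q (dvdn_leq_log _ l0 ml).
Qed.

(** For a unital size n = c b, st(eAe) = c b t, and its quotient c t by b is attained by an
    idempotent of rank c. *)
Lemma Spec_dvd_fin s1 s2 : Spec A s2 -> dvd_fin s1 s2 -> Spec A s1.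
Proof.
move=> [e [e0 ee] <-] [b Omega_b ->].
have [n size_n /dvdnP[c nE]] := Omega_st e0 ee Omega_b.
have b0 : (0 < b)%N by case: Omega_b.
have n0 : (0 < n)%N by case: size_n.
have c0 : (0 < c)%N by move: n0; rewrite nE muln_gt0 => /andP[].
have [|t -> Spec_t] := Spec_unital_size (r := c) size_n.
  by rewrite c0 nE leq_pmulr.
by rewrite nE mulnC sn_of_natM // -sn_mulA sn_mulKn.
Qed.

Lemma Spec_mul_interval s n : Spec A s -> Spec A (sn_mul (sn_of_nat n) s) ->
  forall i, (0 < i <= n)%N -> Spec A (sn_mul (sn_of_nat i) s).
Proof.
move=> [e [e0 ee] <-] [f [f0 ff] st_f] i /andP[i0 le_in].
have n0 := leq_trans i0 le_in.
(* If the exponent of p in s = st(eAe) is infinite, some p^i c is the size of a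
   unital matrix subalgebra of eAe. Writing s = p^i c t, p^i is absorbed by t, so
   i s = i c t, and i c <= p^i c leaves room inside e for rank i c. If all
   exponents are finite, n s = st(fAf) forces n rank(e) = rank(f), so rank
   i rank(e) is available in any matrix subalgebra containing e and f. *)
have [[p p_inf]|/forallNP fin] := pselect (exists p, st (corner e) p = Inf).
  have [n' size_n' i_n'] := @st_le_ex e p i e0 ee ltac:(by rewrite p_inf).
  have pr_p := valP p; have n'0 : (0 < n')%N by case: size_n'.
  have /dvdnP[c n'E] : (val p ^ i %| n')%N by rewrite pfactor_dvdn.
  have c0 : (0 < c)%N by move: n'0; rewrite n'E muln_gt0 => /andP[].
  have pi0 : (0 < val p ^ i)%N by rewrite expn_gt0 prime_gt0.
  have i_pi : (i <= val p ^ i)%N by apply/ltnW/ltn_expl/prime_gt1.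
  have [|t st_e Spec_t] := Spec_unital_size (r := c * i) size_n'.
    by rewrite muln_gt0 c0 i0 n'E leq_mul2l i_pi orbT.
  have t_inf : t p = Inf.
    by move: p_inf; rewrite st_e /sn_mul; case: (t p).
  move: Spec_t; rewrite st_e n'E !sn_of_natM // -[in X in _ -> X]sn_mulA.
  by rewrite sn_mul_pfactor // sn_mulA -!sn_of_natM // mulnC.
have [N [phi [E1 [E2 [inj phiM [E1e E11 r1] [E2f E22 r2]]]]]] :=
  idem_common e0 ee f0 ff.
have [t [st1 st2]] := st_common inj phiM E11 E22 r1 r2.
rewrite E1e in st1; rewrite E2f in st2.
have t_fin p : t p <> Inf.
  by move=> tp; apply: (fin p); rewrite st1 /sn_mul tp.
have r2E : (n * \rank E1)%N = \rank E2.
  apply: (sn_mul_of_nat_inj _ r2 t_fin); first by rewrite muln_gt0 n0.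
  by rewrite sn_of_natM // -sn_mulA -st1 -st2.
have irN : (i * \rank E1 <= N)%N.
  by apply: leq_trans (rank_leq_row E2); rewrite -r2E leq_mul2r le_in orbT.
have ir0 : (0 < i * \rank E1)%N by rewrite muln_gt0 i0.
have rk : \rank (pid_mx (i * \rank E1) : 'M[F]_N) = (i * \rank E1)%N.
  by rewrite rank_pid_mx.
(* A new common factor [t'] is taken for e and the idempotent of rank i rank(e); [t] served to
   compare the ranks of e and f. *)
have := st_common inj phiM E11 (pid_mx_idem F irN) r1.
rewrite rk E1e => /(_ ir0)[t' [st_e st_g]].
rewrite st_e sn_mulA -sn_of_natM // -st_g.
exists (phi (pid_mx (i * \rank E1))) => //.
split; last by rewrite -phiM pid_mx_idem.
rewrite -(linear0 phi) => /inj/(congr1 (@mxrank F N N)).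
by rewrite mxrank0 rk => r_0; rewrite r_0 in ir0.
Qed.

End UnitalSize.

Theorem theorem1 (F : fieldType) (A : assocAlgType F) (hA : locally_matrix A) :
  saturated (Spec A).
Proof.
split; first exact: Spec_rationally_connected.
  by move=> s1 s2; exact: Spec_dvd_fin.
by move=> s n _ Spec_s Spec_ns i; exact: Spec_mul_interval.
Qed.
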